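(* Let $Q$ be a cluster quiver without (oriented) $3$-cycles, with $Q_0=\{1,2,\dots,n\}$. Fix a vertex $k\in Q_0$, let $B=B(Q)=(b_{ij})_{n\times n}$ be the exchange matrix of $Q$, and let $$W=\begin{bmatrix} I_{k-1}&\xi&\mathbf{0}\\ \mathbf{0}&-1&\mathbf{0}\\ \mathbf{0}&\eta&I_{n-k}\end{bmatrix},\quad \xi=([b_{1,k}]_+,\dots,[b_{k-1,k}]_+)^T,\quad \eta=([b_{k+1,k}]_+,\dots,[b_{n,k}]_+)^T,$$ so that $\mu_k(B)=WBW^T$. The following statements are equivalent: (i) $Q$ and $\mu_k(Q)$ are cospectral; (ii) $k$ is either a sink or a source of $Q$; (iii) for some $\varepsilon\in\{0,1\}$, $$W=\begin{bmatrix} I_{k-1}&\varepsilon\zeta&\mathbf{0}\\ \mathbf{0}&-1&\mathbf{0}\\ \mathbf{0}&\varepsilon\theta&I_{n-k}\end{bmatrix},\quad\text{where }\zeta=(b_{1,k},\dots,b_{k-1,k})^T,\ \theta=(b_{k+1,k},\dots,b_{n,k})^T.$$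
   Context: A cluster quiver is a finite quiver (multiple arrows allowed) without loops or oriented 2-cycles. Its exchange matrix $B(Q)=(b_{ij})$ is the integer skew-symmetric matrix with $b_{ij}$ equal to the number of arrows $i\to j$ minus the number of arrows $j\to i$. A $3$-cycle is an oriented path of length 3 ending at the vertex where it starts. $[x]_+=\max\{x,0\}$, and $I_m$ is the $m\times m$ identity matrix. A sink is a vertex at which no arrow starts; a source is a vertex at which no arrow ends. The mutation $\mu_k(Q)$ at vertex $k$ is the cluster quiver whose exchange matrix is $\mu_k(B)=(b'_{ij})$ with $b'_{ij}=-b_{ij}$ if $i=k$ or $j=k$, and $b'_{ij}=b_{ij}+\mathrm{sgn}(b_{ik})\max\{b_{ik}b_{kj},0\}$ otherwise. Two cluster quivers are cospectral if their exchange matrices have the same characteristic polynomial. *)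

(* Defs.v *)
From mathcomp Require Import all_boot all_order all_algebra.

Set Implicit Arguments.
Unset Strict Implicit.
Unset Printing Implicit Defensive.

Import Order.TTheory GRing.Theory Num.Theory.
Local Open Scope ring_scope.

(* The vertices 1, ..., n are encoded as 'I_n, i.e. shifted to 0, ..., n-1. *)
Record cluster_quiver (n : nat) := ClusterQuiver {
  arrow : finType;
  src : arrow -> 'I_n;
  tgt : arrow -> 'I_n;
  no_loop : forall a, src a <> tgt a;
  no_2cycle : forall a b, ~ (tgt a = src b /\ tgt b = src a)
}.

Arguments src {n} c _.
Arguments tgt {n} c _.

Definition narrows n (Q : cluster_quiver n) (i j : 'I_n) : nat :=
  #|[set a : arrow Q | (src Q a == i) && (tgt Q a == j)]|.

Definition exchange_mx n (Q : cluster_quiver n) : 'M[int]_n :=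
  \matrix_(i, j) ((narrows Q i j)%:Z - (narrows Q j i)%:Z).

Definition is_sink n (Q : cluster_quiver n) (k : 'I_n) : Prop :=
  forall a : arrow Q, src Q a <> k.

Definition is_source n (Q : cluster_quiver n) (k : 'I_n) : Prop :=
  forall a : arrow Q, tgt Q a <> k.

Definition has_3cycle n (Q : cluster_quiver n) : Prop :=
  exists a b c : arrow Q,
    [/\ tgt Q a = src Q b, tgt Q b = src Q c & tgt Q c = src Q a].

Definition cospectral m n (Q : cluster_quiver m) (Q' : cluster_quiver n) :
    Prop :=
  char_poly (exchange_mx Q) = char_poly (exchange_mx Q').

Definition pos_part (x : int) : int := Num.max x 0.

Definition skew_symmetric n (B : 'M[int]_n) : Prop := B^T = - B.

Definition mutate_mx n (k : 'I_n) (B : 'M[int]_n) : 'M[int]_n :=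
  \matrix_(i, j)
    if (i == k) || (j == k) then - B i j
    else B i j + Num.sg (B i k) * Num.max (B i k * B k j) 0.

Lemma skewE n (B : 'M[int]_n) (i j : 'I_n) :
  skew_symmetric B -> B i j = - B j i.
Proof. by move=> /matrixP/(_ j i); rewrite !mxE. Qed.

Lemma skew_diag n (B : 'M[int]_n) (i : 'I_n) : skew_symmetric B -> B i i = 0.
Proof.
move=> sB; have /eqP := skewE i i sB.
by rewrite -subr_eq0 opprK -mulr2n mulrn_eq0 /= => /eqP.
Qed.

Lemma exchange_mx_skew n (Q : cluster_quiver n) : skew_symmetric (exchange_mx Q).
Proof. by apply/matrixP => i j; rewrite !mxE opprB. Qed.

Lemma mutate_mx_skew n (k : 'I_n) (B : 'M[int]_n) :
  skew_symmetric B -> skew_symmetric (mutate_mx k B).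
Proof.
move=> sB; apply/matrixP => i j; rewrite !mxE orbC.
case: ifP => _; first by rewrite (skewE j i sB).
rewrite (skewE j i sB) opprD; congr (_ + _).
rewrite (skewE k i sB) (skewE k j sB) !mulrN (mulrC (B j k)).
case: (ltgtP (B i k * B j k) 0) => [lt0|gt0|eq0].
- have -> : Num.sg (B j k) = - Num.sg (B i k).
    have ik0 : B i k != 0 by apply: contraTneq lt0 => ->; rewrite mul0r ltxx.
    apply: (mulfI (x := Num.sg (B i k))); first by rewrite sgr_eq0.
    by rewrite -sgrM (ltr0_sg lt0) mulrN -expr2 sqr_sg ik0.
  by rewrite mulNr.
- by rewrite max_r ?mulr0 ?oppr0 // oppr_le0 ltW.
- by rewrite eq0 oppr0 maxxx !mulr0 oppr0.
Qed.

Definition mx_arrow n (B : 'M[int]_n) : finType :=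
  {p : 'I_n * 'I_n & 'I_(`|pos_part (B p.1 p.2)|%N)}.

Lemma mx_arrow_gt0 n (B : 'M[int]_n) (a : mx_arrow B) : 0 < B (tag a).1 (tag a).2.
Proof.
case: a => p /= x; rewrite ltNge; apply/negP => le0.
by case: x => x; rewrite /pos_part (max_r le0).
Qed.

Lemma mx_no_loop n (B : 'M[int]_n) (sB : skew_symmetric B)
    (a : mx_arrow B) : (tag a).1 <> (tag a).2.
Proof. by move=> e; have := mx_arrow_gt0 a; rewrite -e skew_diag. Qed.

Lemma mx_no_2cycle n (B : 'M[int]_n) (sB : skew_symmetric B)
    (a b : mx_arrow B) :
  ~ ((tag a).2 = (tag b).1 /\ (tag b).2 = (tag a).1).
Proof.
move=> [e1 e2]; have := mx_arrow_gt0 a; rewrite e1 -e2 skewE // oppr_gt0.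
by rewrite ltNge (ltW (mx_arrow_gt0 b)).
Qed.

(* The cluster quiver, unique up to isomorphism, with exchange matrix [B]:
   it has [B i j]_+ arrows from i to j. *)
Definition quiver_of_mx n (B : 'M[int]_n) (sB : skew_symmetric B) :
    cluster_quiver n :=
  @ClusterQuiver n (mx_arrow B) (fun a => (tag a).1) (fun a => (tag a).2)
    (mx_no_loop sB) (mx_no_2cycle sB).

Lemma narrows_quiver_of_mx n (B : 'M[int]_n) (sB : skew_symmetric B)
    (i j : 'I_n) :
  narrows (quiver_of_mx sB) i j = `|pos_part (B i j)|%N.
Proof.
rewrite /narrows.
pose f (x : 'I_(`|pos_part (B i j)|%N)) : mx_arrow B :=
  Tagged (fun p : 'I_n * 'I_n => 'I_(`|pos_part (B p.1 p.2)|%N))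
    (x : 'I_(`|pos_part (B (i, j).1 (i, j).2)|%N)).
rewrite -[RHS]card_ord -(card_imset (f := f)); last first.
  by move=> x y /eqP; rewrite /f -tag_eqE /tag_eq /= eqxx tagged_asE => /eqP.
apply: eq_card => a; rewrite inE; apply/idP/imsetP => /=.
- case: a => [[i' j'] x] /= /andP[/eqP ei /eqP ej]; subst i' j'.
  by exists x.
- by case=> x _ ->; rewrite /= !eqxx.
Qed.

Lemma exchange_quiver_of_mx n (B : 'M[int]_n) (sB : skew_symmetric B) :
  exchange_mx (quiver_of_mx sB) = B.
Proof.
apply/matrixP => i j; rewrite !mxE !narrows_quiver_of_mx /pos_part.
rewrite (skewE j i sB) !abszE !ger0_norm ?le_max ?lexx ?orbT //.
case: (leP (B i j) 0) => h.
- by rewrite max_l ?oppr_ge0 // sub0r opprK.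
- by rewrite max_r ?subr0 // oppr_le0 ltW.
Qed.

Definition mutate n (k : 'I_n) (Q : cluster_quiver n) : cluster_quiver n :=
  quiver_of_mx (mutate_mx_skew k (exchange_mx_skew Q)).

Lemma exchange_mutate n (k : 'I_n) (Q : cluster_quiver n) :
  exchange_mx (mutate k Q) = mutate_mx k (exchange_mx Q).
Proof. exact: exchange_quiver_of_mx. Qed.

(* The block matrix [ I_(k-1) v' 0 ; 0 -1 0 ; 0 v'' I_(n-k) ], where v' and v''
   collect the [v i] with i < k and with i > k; the value [v k] is unused. *)
Definition col_replaced_mx n (k : 'I_n) (v : 'I_n -> int) : 'M[int]_n :=
  \matrix_(i, j)
    if j == k then (if i == k then -1 else v i) else (i == j)%:R.

Definition mutation_W n (k : 'I_n) (B : 'M[int]_n) : 'M[int]_n :=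
  col_replaced_mx k (fun i => pos_part (B i k)).

(* Main.v *)
Require Import Defs.
From mathcomp Require Import all_boot all_order all_algebra.
From mathcomp Require Import zify.

Import Order.TTheory GRing.Theory Num.Theory.
Local Open Scope ring_scope.

(** Everything rests on one spectral invariant of a skew-symmetric matrix [B]:
    its characteristic polynomial determines the sum of the squares of its
    entries, because that sum is [- \tr (B ^ 2)] ([cospectral_skew_sum_sqr]).

    Outside the row and the column of [k], mutation at [k] changes the entry
    [b_ij] exactly when [i] and [j] are joined by a path through [k], in either
    direction, that is when [b_ik * b_kj > 0]; it then adds [b_ik * b_kj] with
    the sign of [b_ik].  Without oriented 3-cycles, no
    arrow closes such a path, so [b_ij] is zero or already has that sign, and
    its square strictly increases ([sqr_mutate_mx_le]).  Squares never decrease,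
    so a mutation that preserves the spectrum changes no entry away from the
    row and the column of [k]: there is no path through [k], and [k] is a sink
    or a source.

    Conversely, at a sink or a source the column [b_ik] has constant sign.  Its
    positive part is then the column itself or zero, which is the special form
    of [W].  Such a constant sign also reduces mutation to a change of sign of
    the row and the column of [k], which is conjugation by a diagonal matrix of
    signs ([mutate_mx_sign_conj]) and preserves the characteristic
    polynomial. *)

(** * Characteristic polynomials *)

Lemma char_poly_conj (R : comNzRingType) (n : nat) (P P' A : 'M[R]_n) :
  P *m P' = 1%:M -> char_poly (P *m A *m P') = char_poly A.
Proof.
move=> PP'; rewrite /char_poly /char_poly_mx.
have PP'X : map_mx polyC P *m map_mx polyC P' = 1%:M.
  by rewrite -map_mxM PP' map_scalar_mx.
have -> : 'X%:M - map_mx polyC (P *m A *m P') =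
    map_mx polyC P *m ('X%:M - map_mx polyC A) *m map_mx polyC P'.
  rewrite mulmxBr mulmxBl !map_mxM; congr (_ - _).
  by rewrite mul_mx_scalar -scalemxAl PP'X scale_scalar_mx mulr1.
by rewrite !det_mulmx mulrAC -det_mulmx PP'X det1 mul1r.
Qed.

(** The factorization is [X^2 - B^2 = (X - B) (X + B)]; for a skew-symmetric
    [B] the factors are transposes of each other, hence have the same
    determinant. *)
Lemma char_poly_skew_sqr (n : nat) (B : 'M[int]_n) :
  skew_symmetric B ->
  char_poly (B *m B) \Po 'X^2 = char_poly B ^+ 2.
Proof.
move=> sB; rewrite /char_poly -det_map_mx /=.
have -> : map_mx (comp_poly 'X^2) (char_poly_mx (B *m B)) =
    char_poly_mx B *m (char_poly_mx B)^T.
  rewrite /char_poly_mx map_mxB map_scalar_mx /= comp_polyX.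
  have -> : map_mx (comp_poly 'X^2) (map_mx polyC (B *m B)) =
      map_mx polyC (B *m B).
    by rewrite -map_mx_comp; apply: eq_map_mx => x /=; rewrite comp_polyC.
  rewrite linearB /= tr_scalar_mx map_trmx sB map_mxN opprK.
  rewrite mulmxDr !mulmxBl !mul_scalar_mx mul_mx_scalar map_mxM.
  by rewrite scale_scalar_mx expr2 addrA subrK.
by rewrite det_mulmx det_tr expr2.
Qed.

Lemma tr_skew_sqr (n : nat) (B : 'M[int]_n) :
  skew_symmetric B -> \tr (B *m B) = - \sum_i \sum_j B i j ^+ 2.
Proof.
move=> sB; rewrite /mxtrace -sumrN; apply: eq_bigr => i _.
rewrite mxE -sumrN; apply: eq_bigr => j _.
by rewrite (skewE j i sB) mulrN expr2.
Qed.

(** The characteristic polynomial of [B] determines that of [B *m B], hence its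
    trace.  Since that of [B *m B] occurs composed with ['X^2], the trace is
    read off at twice the usual index. *)
Lemma cospectral_skew_sum_sqr (n : nat) (A B : 'M[int]_n) :
  skew_symmetric A -> skew_symmetric B -> char_poly A = char_poly B ->
  \sum_i \sum_j A i j ^+ 2 = \sum_i \sum_j B i j ^+ 2.
Proof.
case: n A B => [|n] A B sA sB eqAB; first by rewrite !big_ord0.
apply: oppr_inj; rewrite -!tr_skew_sqr //; apply: oppr_inj.
rewrite -!char_poly_trace //=.
have := congr1 (fun p : {poly int} => p`_(n * 2)) (char_poly_skew_sqr _ _ sA).
rewrite eqAB -(char_poly_skew_sqr _ _ sB) /=.
by rewrite !coef_comp_poly_Xn // dvdn_mull // mulnK.
Qed.

(** * Arrows and the signs of the exchange matrix *)

Lemma exchange_mx_arrow (n : nat) (Q : cluster_quiver n) (a : arrow Q) :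
  0 < exchange_mx Q (src Q a) (tgt Q a).
Proof.
rewrite mxE.
have -> : narrows Q (tgt Q a) (src Q a) = 0%N.
  apply: eq_card0 => b; rewrite inE; apply/negP => /andP[/eqP e1 /eqP e2].
  exact: (@no_2cycle _ Q a b).
rewrite subr0 ltz_nat; apply/card_gt0P; exists a.
by rewrite inE !eqxx.
Qed.

Lemma exchange_mx_gt0 (n : nat) (Q : cluster_quiver n) (i j : 'I_n) :
  0 < exchange_mx Q i j -> exists2 a, src Q a = i & tgt Q a = j.
Proof.
rewrite mxE subr_gt0 ltz_nat => lt_narrows.
have /card_gt0P[a] : (0 < narrows Q i j)%N by apply: leq_trans lt_narrows.
by rewrite inE => /andP[/eqP ? /eqP ?]; exists a.
Qed.

Lemma exchange_mx_no_3cycle (n : nat) (Q : cluster_quiver n) (i j k : 'I_n) :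
  ~ has_3cycle Q -> 0 < exchange_mx Q i k -> 0 < exchange_mx Q k j ->
  0 <= exchange_mx Q i j.
Proof.
move=> noQ /exchange_mx_gt0[a ai ak] /exchange_mx_gt0[b bk bj].
rewrite (skewE _ _ (exchange_mx_skew Q)) oppr_ge0 leNgt; apply/negP.
move=> /exchange_mx_gt0[c cj ci]; apply: noQ; exists a, b, c.
by rewrite ai ak bk bj cj ci.
Qed.

Lemma is_sinkP (n : nat) (Q : cluster_quiver n) (k : 'I_n) :
  is_sink Q k <-> forall i, 0 <= exchange_mx Q i k.
Proof.
split=> [sink i | nonneg a ak].
  rewrite (skewE _ _ (exchange_mx_skew Q)) oppr_ge0 leNgt; apply/negP.
  by move=> /exchange_mx_gt0[a /sink].
have := nonneg (tgt Q a); rewrite (skewE _ _ (exchange_mx_skew Q)) -ak oppr_ge0.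
by rewrite leNgt exchange_mx_arrow.
Qed.

Lemma is_sourceP (n : nat) (Q : cluster_quiver n) (k : 'I_n) :
  is_source Q k <-> forall i, exchange_mx Q i k <= 0.
Proof.
split=> [source i | nonpos a ak].
  by rewrite leNgt; apply/negP => /exchange_mx_gt0[a _ /source].
by have := nonpos (src Q a); rewrite -ak leNgt exchange_mx_arrow.
Qed.

Lemma sink_or_source (n : nat) (Q : cluster_quiver n) (k : 'I_n) :
  (forall i j, exchange_mx Q i k * exchange_mx Q k j <= 0) ->
  is_sink Q k \/ is_source Q k.
Proof.
move=> nopath; case: (pickP (fun a => src Q a == k)) => [b /eqP bk | noout].
  right=> a ak; have := nopath (src Q a) (tgt Q b).
  by rewrite leNgt -{1}ak -bk mulr_gt0 ?exchange_mx_arrow.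
by left=> a /eqP; rewrite noout.
Qed.

(** * Mutation of matrices *)

Lemma mulmx_col_replaced (n : nat) (k : 'I_n) (v : 'I_n -> int)
    (A : 'M[int]_n) (i j : 'I_n) :
  (col_replaced_mx k v *m A) i j =
  if i == k then - A k j else A i j + v i * A k j.
Proof.
rewrite mxE (bigD1 k) //= mxE eqxx; case: (eqVneq i k) => [-> | nik].
  rewrite mulN1r big1 ?addr0 // => l nlk.
  by rewrite mxE (negPf nlk) eq_sym (negPf nlk) mul0r.
rewrite addrC (bigD1 i) //= mxE (negPf nik) eqxx mul1r big1 ?addr0 //.
move=> l /andP[nlk nli].
by rewrite mxE (negPf nlk) eq_sym (negPf nli) mul0r.
Qed.

(** Left multiplication by [W] adds [[b_ik]_+] times row [k] to row [i].  Doing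
    the same on columns gives [b_ij + [b_ik]_+ * b_kj + [b_jk]_+ * b_ik] away
    from [k]; the last two terms cancel or vanish when [b_ik * b_kj <= 0], and
    exactly one of them is nonzero otherwise. *)
Lemma mutate_mx_congr (n : nat) (k : 'I_n) (B : 'M[int]_n) :
  skew_symmetric B ->
  mutate_mx k B = mutation_W k B *m B *m (mutation_W k B)^T.
Proof.
move=> sB; apply/matrixP => i j.
have -> : mutation_W k B *m B *m (mutation_W k B)^T =
    (mutation_W k B *m (mutation_W k B *m B)^T)^T.
  by rewrite trmx_mul trmxK.
rewrite [RHS]mxE mulmx_col_replaced [_^T k i]mxE [_^T j i]mxE.
rewrite !mulmx_col_replaced [LHS]mxE.
have Bkk : B k k = 0 by apply: skew_diag.
rewrite /pos_part (skewE j k sB).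
case: (eqVneq i k) => [->|_]; case: (eqVneq j k) => [->|_] /=;
  rewrite ?Bkk; lia.
Qed.

(** When [b_ik * b_kj > 0], the hypotheses, which follow from the absence
    of 3-cycles, make [b_ij] zero or of the same sign as the term added to it, so
    nothing cancels.  Otherwise mutation at most changes the sign of [b_ij]. *)
Lemma sqr_mutate_mx_le (n : nat) (k : 'I_n) (B : 'M[int]_n) (i j : 'I_n) :
  skew_symmetric B ->
  (0 < B i k -> 0 < B k j -> 0 <= B i j) ->
  (B i k < 0 -> B k j < 0 -> B i j <= 0) ->
  B i j ^+ 2 <= mutate_mx k B i j ^+ 2
    ?= iff (B i k * B k j <= 0).
Proof.
move=> sB pos neg; have Bkk : B k k = 0 by apply: skew_diag.
rewrite mxE; case: ifP => [/orP[]/eqP-> | _].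
- by rewrite Bkk mul0r lexx sqrrN; apply/leif_refl.
- by rewrite Bkk mulr0 lexx sqrrN; apply/leif_refl.
case: (leP (B i k * B k j) 0) => [le0 | gt0].
  by rewrite mulr0 addr0; apply/leif_refl.
have lt_sqr : B i j ^+ 2 < (B i j + Num.sg (B i k) * (B i k * B k j)) ^+ 2.
  case: (ltgtP (B i k) 0) gt0 => [ik0 | ik0 | ->]; last by rewrite mul0r ltxx.
  - rewrite nmulr_rgt0 // => kj0; rewrite ltr0_sg // mulN1r.
    have := neg ik0 kj0; nia.
  - rewrite pmulr_rgt0 // => kj0; rewrite gtr0_sg // mul1r.
    have := pos ik0 kj0; nia.
by split; [exact: ltW | exact: lt_eqF].
Qed.

Definition sign_mx (n : nat) (k : 'I_n) : 'M[int]_n :=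
  diag_mx (\row_i (-1) ^+ (i == k)).

Lemma sign_mxK (n : nat) (k : 'I_n) : sign_mx n k *m sign_mx n k = 1%:M.
Proof.
apply/matrixP => i j; rewrite mul_diag_mx !mxE.
by case: (i == j); rewrite ?mulr0n ?mulr0 // !mulr1n -expr2 sqrr_sign.
Qed.

Lemma mutate_mx_sign_conj (n : nat) (k : 'I_n) (B : 'M[int]_n) :
  skew_symmetric B -> (forall i j, B i k * B k j <= 0) ->
  mutate_mx k B = sign_mx n k *m B *m sign_mx n k.
Proof.
move=> sB nopath; apply/matrixP => i j.
rewrite mul_mx_diag mul_diag_mx !mxE max_r // mulr0 addr0.
case: (eqVneq i k) => [-> | _]; case: (eqVneq j k) => [-> | _] /=;
  rewrite ?(skew_diag k sB); lia.
Qed.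

(** The special form of [W] forces every [[b_ik]_+] to be zero, or every one to
    be [b_ik] itself: the column of [k] has constant sign, and by skew-symmetry
    the row of [k] has the opposite sign. *)
Lemma special_W_nopath (n : nat) (k : 'I_n) (B : 'M[int]_n) (eps : int) :
  skew_symmetric B -> eps = 0 \/ eps = 1 ->
  mutation_W k B = col_replaced_mx k (fun i => eps * B i k) ->
  forall i j, B i k * B k j <= 0.
Proof.
move=> sB eps01 eqW i j; rewrite (skewE k j sB).
have pos l : pos_part (B l k) = eps * B l k.
  have := congr1 (fun M : 'M_n => M l k) eqW; rewrite !mxE eqxx.
  by case: eqVneq => [-> _ | _ //]; rewrite /pos_part (skew_diag k sB) mulr0.
have := pos i; have := pos j; rewrite /pos_part.
by case: eps01 => ->; nia.
Qed.

Theorem proposition4p5 (n : nat) (Q : cluster_quiver n) (k : 'I_n)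
    (no_3cycle : ~ has_3cycle Q) :
  let B := exchange_mx Q in
  let W := mutation_W k B in
  mutate_mx k B = W *m B *m W^T /\
  [<-> cospectral Q (mutate k Q);
       is_sink Q k \/ is_source Q k;
       exists2 eps : int, eps = 0 \/ eps = 1 &
         W = col_replaced_mx k (fun i => eps * B i k)].
Proof.
move=> B W; have sB : skew_symmetric B by apply: exchange_mx_skew.
split; first exact: mutate_mx_congr.
tfae.
- rewrite /cospectral exchange_mutate -/B => eq_char.
  have le_sqr i j : B i j ^+ 2 <= mutate_mx k B i j ^+ 2
      ?= iff (B i k * B k j <= 0).
    apply: sqr_mutate_mx_le => // [|ik0 kj0]; first exact: exchange_mx_no_3cycle.
    (* A path from [j] to [i] through [k], read with [i] and [j] exchanged. *)
    rewrite (skewE i j sB) oppr_le0; apply: (@exchange_mx_no_3cycle _ _ _ _ k) => //.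
      by rewrite -/B (skewE j k sB) oppr_gt0.
    by rewrite -/B (skewE k i sB) oppr_gt0.
  have := cospectral_skew_sum_sqr _ _ _ sB (mutate_mx_skew k sB) eq_char.
  move/eqP; have [_ ->] := leif_sum (fun i (_ : true) =>
    leif_sum (fun j (_ : true) => le_sqr i j)).
  move=> /forallP nopath; apply: sink_or_source => i j.
  by have /forallP/(_ j) := nopath i.
- case=> [/is_sinkP nonneg | /is_sourceP nonpos].
    exists 1; first by right.
    apply/matrixP => i j; by rewrite [LHS]mxE [RHS]mxE mul1r /pos_part max_l ?nonneg.
  exists 0; first by left.
  apply/matrixP => i j; by rewrite [LHS]mxE [RHS]mxE mul0r /pos_part max_r ?nonpos.
- case=> eps eps01 eqW; rewrite /cospectral exchange_mutate -/B.
  rewrite (mutate_mx_sign_conj _ _ _ sB (special_W_nopath _ _ _ _ sB eps01 eqW)).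
  by rewrite char_poly_conj // sign_mxK.
Qed.
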